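(* Let $m=m(n)>n$, $N=N(n)$, $d=d(n)$ with $N,d\le\mathrm{poly}(m)$. Assume there exists a demi-bits generator $\{G_n:\{0,1\}^n\to\{0,1\}^N\}$ and that $\mathsf{Ext}:\{0,1\}^N\times\{0,1\}^d\to\{0,1\}^m$ is an $(N-1,2^{-m-1})$-strong seeded extractor. Then the range avoidance problem restricted to polynomial-size circuits with $n$ inputs and $m$ outputs is not in $\mathbf{SearchNP}$.
   Context: Range avoidance: given a circuit $C:\{0,1\}^n\to\{0,1\}^m$ with $m>n$, output $y\notin\mathrm{Range}(C)$. $\mathbf{SearchNP}$: search problems solvable by a nondeterministic polynomial-time machine $M$ such that on every input having a solution, $M$ has an accepting path and every accepting path outputs a valid solution, and on inputs without solutions $M$ has no accepting path. A random variable $X$ is a $k$-source if $\Pr[X=x]\le 2^{-k}$ for all $x$. A polynomial-time computable $\mathsf{Ext}:\{0,1\}^N\times\{0,1\}^d\to\{0,1\}^m$ is a $(k,\varepsilon)$-strong seeded extractor if for every $k$-source $X$ on $\{0,1\}^N$, the statistical distance between $(U_d,\mathsf{Ext}(X,U_d))$ and $(U_d,U_m)$ is at most $\varepsilon$. A family $\{G_n:\{0,1\}^n\to\{0,1\}^{N(n)}\}$ with $N(n)>n$, computable by polynomial-size circuits, is a demi-bits generator (secure against $\mathbf{NP}/\mathrm{poly}$) if for every family $\{D\}$ of polynomial-size nondeterministic circuits and all sufficiently large $n$, it is not the case that both $\Pr_{y\sim\{0,1\}^{N}}[D(y)=1]\ge 1/3$ and $D(G_n(x))=0$ for all $x$.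 *)

(* Defs.v *)
From HB Require Import structures.
From mathcomp Require Import all_boot all_order all_algebra.
From Stdlib Require Import Rdefinitions.
From mathcomp Require Import Rstruct.

Set Implicit Arguments.
Unset Strict Implicit.
Unset Printing Implicit Defensive.

Import Order.TTheory GRing.Theory Num.Theory.

Definition poly_bounded (f g : nat -> nat) : Prop :=
  exists c : nat, forall n, f n <= c * (g n) ^ c + c.

Inductive gate : Type :=
| GAnd of nat & nat
| GOr  of nat & nat
| GNot of nat.

(** A circuit with [cin] input wires (wires 0 .. cin-1); gate number k
    defines wire [cin + k] and may read any earlier wire; [outs] lists
    the output wires. *)
Record circuit : Type := Circuit {
  cin   : nat;
  gates : seq gate;
  outs  : seq nat }.

Definition gval (ws : seq bool) (g : gate) : bool :=
  match g with
  | GAnd i j => nth false ws i && nth false ws j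
  | GOr i j  => nth false ws i || nth false ws j
  | GNot i   => ~~ nth false ws i
  end.

Definition ceval (C : circuit) (x : seq bool) : seq bool :=
  let ws := foldl (fun ws g => rcons ws (gval ws g)) x (gates C) in
  map (nth false ws) (outs C).

Definition csize (C : circuit) : nat := cin C + size (gates C) + size (outs C).

Definition has_shape (C : circuit) (a b : nat) : Prop :=
  cin C = a /\ size (outs C) = b.

Definition in_range (C : circuit) (y : seq bool) : Prop :=
  exists x : (cin C).-tuple bool, ceval C x = y.

(** Nondeterministic circuit: the first [k] inputs are the real input,
    the remaining [cin D - k] are witness bits; D(y) = 1 iff some witness
    makes the (single) output 1. *)
Definition ndeval (D : circuit) (k : nat) (y : seq bool) : bool :=
  [exists z : (cin D - k).-tuple bool, ceval D (y ++ z) == [:: true]].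

Definition nd_family (N : nat -> nat) (D : nat -> circuit) : Prop :=
  (forall n, N n <= cin (D n) /\ size (outs (D n)) = 1)
  /\ poly_bounded (fun n => csize (D n)) (fun n => n).

Definition demibits_generator (N : nat -> nat) (G : nat -> circuit) : Prop :=
  (forall n, n < N n)
  /\ (forall n, has_shape (G n) n (N n))
  /\ poly_bounded (fun n => csize (G n)) (fun n => n)
  /\ forall D : nat -> circuit, nd_family N D ->
       exists n0, forall n, n0 <= n ->
         ~ ( (* Pr_y[D(y) = 1] >= 1/3 *)
             2 ^ N n <= 3 * #|[set y : (N n).-tuple bool | ndeval (D n) (N n) y]|
             /\ forall x : n.-tuple bool, ~~ ndeval (D n) (N n) (ceval (G n) x)).

Local Open Scope ring_scope.

Definition pow2inv (k : nat) : R := ((2 : R) ^+ k)^-1.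

Definition ksource (N : nat) (X : {ffun N.-tuple bool -> R}) (k : nat) : Prop :=
  (forall x, 0 <= X x) /\ (\sum_x X x = 1) /\ (forall x, X x <= ((2 : R) ^+ k)^-1).

(** Statistical distance between (U_d, Ext(X, U_d)) and (U_d, U_m). *)
Definition sd_strong (N d m : nat)
    (E : N.-tuple bool -> d.-tuple bool -> m.-tuple bool)
    (X : {ffun N.-tuple bool -> R}) : R :=
  2^-1 * \sum_(s : d.-tuple bool) \sum_(z : m.-tuple bool)
     `| ((2 : R) ^+ d)^-1 * (\sum_(x | E x s == z) X x)
        - ((2 : R) ^+ d)^-1 * ((2 : R) ^+ m)^-1 |.

Definition strong_extractor (N d m : nat)
    (E : N.-tuple bool -> d.-tuple bool -> m.-tuple bool) (k : nat) (eps : R) : Prop :=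
  forall X : {ffun N.-tuple bool -> R}, ksource X k -> sd_strong E X <= eps.

Local Close Scope ring_scope.

Inductive move : Type := MLeft | MRight | MStay.

(** Tape alphabet: [None] is the blank, [Some b] a bit. *)
Record ntm : Type := NTM {
  state : finType;
  q0    : state;
  qacc  : state;
  qrej  : state;
  delta : state -> option bool -> seq (state * option bool * move) }.

(** Configuration: state, tape left of the head (nearest cell first),
    head cell, tape right of the head. *)
Definition config (M : ntm) : Type :=
  (state M * seq (option bool) * option bool * seq (option bool))%type.

Definition init (M : ntm) (x : seq bool) : config M :=
  match x with
  | [::] => (q0 M, [::], None, [::])
  | b :: x' => (q0 M, [::], Some b, map Some x')
  end.

Definition do_move (M : ntm) (q : state M) (l : seq (option bool)) (a : option bool)
    (r : seq (option bool)) (mv : move) : config M :=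
  match mv with
  | MStay => (q, l, a, r)
  | MLeft => match l with
             | [::] => (q, [::], None, a :: r)
             | c :: l' => (q, l', c, a :: r)
             end
  | MRight => match r with
              | [::] => (q, a :: l, None, [::])
              | c :: r' => (q, a :: l, c, r')
              end
  end.

Definition halting (M : ntm) (q : state M) : bool := (q == qacc M) || (q == qrej M).

Inductive step (M : ntm) : config M -> config M -> Prop :=
| Step (q : state M) (l : seq (option bool)) (h : option bool)
       (r : seq (option bool)) (q' : state M) (a : option bool) (mv : move) :
    ~~ halting q -> List.In (q', a, mv) (delta q h) ->
    step (q, l, h, r) (do_move q' l a r mv).

Inductive reach (M : ntm) : nat -> config M -> config M -> Prop :=
| Reach0 c : reach 0 c c
| ReachS t c c' c'' : step c c' -> reach t c' c'' -> reach t.+1 c c''.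

Fixpoint read_bits (s : seq (option bool)) : seq bool :=
  match s with
  | Some b :: s' => b :: read_bits s'
  | _ => [::]
  end.

Definition output (M : ntm) (c : config M) : seq bool :=
  let: (_, _, h, r) := c in read_bits (h :: r).

Definition cstate (M : ntm) (c : config M) : state M :=
  let: (q, _, _, _) := c in q.

Definition time_bounded (M : ntm) (T : nat -> nat) : Prop :=
  forall x t c, reach t (init M x) c -> t <= T (size x).

Definition poly_time (M : ntm) : Prop :=
  exists c : nat, time_bounded M (fun k => c * k ^ c + c).

Definition accepts_with (M : ntm) (x y : seq bool) : Prop :=
  exists t c, reach t (init M x) c /\ cstate c = qacc M /\ output c = y.

Definition deterministic (M : ntm) : Prop :=
  forall q a, size (@delta M q a) <= 1.

Definition ptime_ext (N d m : nat -> nat)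
    (E : forall n, (N n).-tuple bool -> (d n).-tuple bool -> (m n).-tuple bool) : Prop :=
  exists M : ntm, deterministic M /\ poly_time M /\
    forall n (x : (N n).-tuple bool) (s : (d n).-tuple bool),
      accepts_with M (nseq n true ++ false :: (val x ++ val s)) (val (E n x s)).

Definition enc_nat (k : nat) : seq bool := nseq k true ++ [:: false].

Definition enc_gate (g : gate) : seq bool :=
  match g with
  | GAnd i j => [:: false; false] ++ enc_nat i ++ enc_nat j
  | GOr i j  => [:: false; true] ++ enc_nat i ++ enc_nat j
  | GNot i   => true :: enc_nat i
  end.

Definition enc_circuit (C : circuit) : seq bool :=
  enc_nat (cin C)
  ++ flatten [seq true :: enc_gate g | g <- gates C] ++ [:: false]
  ++ flatten [seq true :: enc_nat o | o <- outs C] ++ [:: false].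

(** Avoid restricted to circuits with n inputs, m(n) outputs and size at
    most p(m(n)) is in SearchNP: some nondeterministic polynomial-time
    machine, on every such instance, has an accepting path, and every
    accepting path outputs a string of length m(n) outside the range.
    (Every instance has a solution since m(n) > n.) *)
Definition avoid_in_SearchNP (m p : nat -> nat) : Prop :=
  exists M : ntm, poly_time M /\
    forall n (C : circuit), has_shape C n (m n) -> csize C <= p (m n) ->
      (exists y, accepts_with M (enc_circuit C) y)
      /\ forall y, accepts_with M (enc_circuit C) y ->
           size y = m n /\ ~ in_range C y.

(* Main.v *)
Require Import Defs.
From HB Require Import structures.
From mathcomp Require Import all_boot all_order all_algebra.
From mathcomp Require Import ring lra zify.
From Stdlib Require Import Rdefinitions IndefiniteDescription.
From mathcomp Require Import Rstruct.

(** If a machine [M] solves Avoid, guess a seed [s] and a run of [M] on the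
    circuit [C_s : x |-> Ext (G x, s)], let [z] be its output, and accept [y]
    when [Ext (y, s) = z].  No [y = G x] is accepted, because [z] avoids the
    range of [C_s].  Fix for every [s] an output [z_s] of [M] on [C_s]; were
    half of all strings rejected, the uniform source on them would never hit
    the pairs [(s, z_s)], which have density [2^-m] under the uniform
    distribution, so the extractor error would be at least [2^-m].  The test is
    a nondeterministic circuit of polynomial size: tableaux of [M] and of the
    machine computing [Ext] are laid out as gates, and the gates of [C_s] are
    chosen so that the seed bits occur verbatim, at fixed positions, in the
    encoding of [C_s] that [M] reads. *)

Set Implicit Arguments.
Unset Strict Implicit.
Unset Printing Implicit Defensive.

(** * Wires and circuits *)

Definition run (g : seq gate) (x : seq bool) : seq bool :=
  foldl (fun ws g => rcons ws (gval ws g)) x g.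

Lemma run_cat g e x : run (g ++ e) x = run e (run g x).
Proof. by rewrite /run foldl_cat. Qed.

Lemma size_run g x : size (run g x) = size x + size g.
Proof.
elim: g x => [|h g IH] x /=; first by rewrite addn0.
by rewrite IH size_rcons addSnnS.
Qed.

Lemma nth_run g x i : i < size x -> nth false (run g x) i = nth false x i.
Proof.
elim: g x => [//|h g IH] x ltix /=.
by rewrite IH ?size_rcons ?ltnS 1?ltnW // nth_rcons ltix.
Qed.

(** The index is fixed before the input is. It lies below the number of existing wires, so gates
    appended later leave its value unchanged. *)
Definition wire (a : nat) (g : seq gate) (f : seq bool -> bool) : Prop :=
  exists2 i, i < a + size g &
    forall x, size x = a -> nth false (run g x) i = f x.

(** One-hot representation: a value in a finite type is available when
    each test for equality with a constant is carried by some wire. *)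
Definition avail (a : nat) (A : finType) (g : seq gate) (f : seq bool -> A) : Prop :=
  forall v, wire a g (fun x => f x == v).

(** Circuits are built by appending gates. The new gates are counted but not named, so the size
    bound comes along with the construction. *)
Definition grow (k : nat) (g : seq gate) (P : seq gate -> Prop) : Prop :=
  exists2 e, size e <= k & P (g ++ e).

Definition mono (P : seq gate -> Prop) : Prop := forall g e, P g -> P (g ++ e).

Lemma grow_ret k g P : P g -> grow k g P.
Proof. by move=> Pg; exists [::]; rewrite ?cats0. Qed.

Lemma grow_bind k1 k2 g (P Q : seq gate -> Prop) :
  grow k1 g P -> (forall e, P (g ++ e) -> grow k2 (g ++ e) Q) ->
  grow (k1 + k2) g Q.
Proof.
move=> [e1 le1 Pe] /(_ _ Pe)[e2 le2 Qe]; exists (e1 ++ e2).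
  by rewrite size_cat leq_add.
by rewrite catA.
Qed.

Lemma grow_weaken k k' g (P Q : seq gate -> Prop) :
  k <= k' -> (forall g', P g' -> Q g') -> grow k g P -> grow k' g Q.
Proof. by move=> lek PQ [e le Pe]; exists e; [exact: leq_trans lek | exact: PQ]. Qed.

Lemma grow_leq k k' g P : k <= k' -> grow k g P -> grow k' g P.
Proof. by move=> lek; apply: grow_weaken. Qed.

Lemma grow_and k1 k2 g (P Q : seq gate -> Prop) :
  mono P -> grow k1 g P -> (forall e, grow k2 (g ++ e) Q) ->
  grow (k1 + k2) g (fun g' => P g' /\ Q g').
Proof.
move=> mP gP gQ; apply: (grow_bind gP) => e Pe.
by have [e' le Qe] := gQ e; exists e' => //; split=> //; apply: mP.
Qed.

(** The items are built one after another, so each must be reachable from any extension of [g];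
    [mono] keeps the earlier ones valid. *)
Lemma grow_all (I : eqType) k (s : seq I) (P : I -> seq gate -> Prop) g :
  (forall i, mono (P i)) -> (forall i e, i \in s -> grow k (g ++ e) (P i)) ->
  grow (k * size s) g (fun g' => forall i, i \in s -> P i g').
Proof.
move=> mP; elim: s g => [|i s IH] g gP; first by apply: grow_ret.
rewrite /= mulnS; apply: (@grow_weaken (k + k * size s) _ _ _ _ _ _ _); last first.
- apply: grow_and (mP i) _ _; first by rewrite -[g]cats0; apply/gP/mem_head.
  move=> e; apply: (IH (g ++ e)) => j e' js.
  by rewrite -catA; apply: gP; rewrite inE js orbT.
- by move=> g' [Pi Ps] j; rewrite inE => /orP[/eqP->//|/Ps].
- by [].
Qed.

(** * Gates, one-hot values and strings of wires *)

Section Avail.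
Variable a : nat.
Implicit Types (g e : seq gate) (f : seq bool -> bool).

Lemma wire_ext g f f' :
  (forall x, size x = a -> f x = f' x) -> wire a g f -> wire a g f'.
Proof. by move=> E [i lti H]; exists i => // x sx; rewrite H ?E. Qed.

Lemma wire_mono f : mono (fun g => wire a g f).
Proof.
move=> g e [i lti H]; exists i.
  by rewrite size_cat addnA ltn_addr.
by move=> x sx; rewrite run_cat nth_run ?size_run ?sx ?H.
Qed.

Lemma avail_ext (A : finType) g (f f' : seq bool -> A) :
  (forall x, size x = a -> f x = f' x) -> avail a g f -> avail a g f'.
Proof. by move=> E H v; apply: wire_ext (H v) => x sx; rewrite E. Qed.

Lemma avail_mono (A : finType) (f : seq bool -> A) : mono (fun g => avail a g f).
Proof. by move=> g e H v; apply: wire_mono. Qed.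

Lemma wire_input g i : i < a -> wire a g (fun x => nth false x i).
Proof.
move=> ltia; exists i; first exact: ltn_addr.
by move=> x sx; rewrite nth_run ?sx.
Qed.

Lemma wire_gate g h f :
  (forall x, size x = a -> gval (run g x) h = f x) -> grow 1 g (fun g' => wire a g' f).
Proof.
move=> E; exists [:: h] => //; exists (a + size g).
  by rewrite size_cat addnA addn1.
by move=> x sx; rewrite run_cat /= nth_rcons size_run sx ltnn eqxx E.
Qed.

Lemma wire_const g (b : bool) : grow 1 g (fun g' => wire a g' (fun _ => b)).
Proof.
case: b.
  (* The index [a + size g] is one past the last existing wire, so it reads the default [false];
     negation turns it into [true]. *)
  apply: (@wire_gate g (GNot (a + size g))) => x sx /=.
  by rewrite nth_default // size_run sx.
apply: (@wire_gate g (GAnd (a + size g) 0)) => x sx /=.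
by rewrite nth_default // size_run sx.
Qed.

Lemma wire_not g f : wire a g f -> grow 1 g (fun g' => wire a g' (fun x => ~~ f x)).
Proof.
by case=> i _ H; apply: (@wire_gate g (GNot i)) => x sx /=; rewrite H.
Qed.

Lemma wire_and g f1 f2 : wire a g f1 -> wire a g f2 ->
  grow 1 g (fun g' => wire a g' (fun x => f1 x && f2 x)).
Proof.
case=> i _ Hi [j _ Hj].
by apply: (@wire_gate g (GAnd i j)) => x sx /=; rewrite Hi ?Hj.
Qed.

Lemma wire_or g f1 f2 : wire a g f1 -> wire a g f2 ->
  grow 1 g (fun g' => wire a g' (fun x => f1 x || f2 x)).
Proof.
case=> i _ Hi [j _ Hj].
by apply: (@wire_gate g (GOr i j)) => x sx /=; rewrite Hi ?Hj.
Qed.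

Lemma wire_has (I : Type) (s : seq I) (F : I -> seq bool -> bool) g :
  (forall i, wire a g (F i)) ->
  grow (size s).+1 g (fun g' => wire a g' (fun x => has (F^~ x) s)).
Proof.
move=> HF; elim: s => [|i s IH] /=; first exact: wire_const.
rewrite -addn1; apply: (grow_bind IH) => e Hs.
by apply: wire_or => //; apply: wire_mono.
Qed.

Lemma wire_all (I : eqType) (s : seq I) (F : I -> seq bool -> bool) g :
  (forall i, i \in s -> wire a g (F i)) ->
  grow (size s).+1 g (fun g' => wire a g' (fun x => all (F^~ x) s)).
Proof.
elim: s => [|i s IH] HF /=; first exact: wire_const.
rewrite -addn1; apply: grow_bind => [|e Hs].
  by apply: IH => j js; apply: HF; rewrite inE js orbT.
by apply: wire_and => //; apply/wire_mono/HF/mem_head.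
Qed.

Lemma avail_bool g f : wire a g f -> grow 1 g (fun g' => avail a g' f).
Proof.
move=> Hf; have [e le He] := wire_not Hf; exists e => // -[].
  by apply: wire_ext (wire_mono e Hf) => x _; rewrite eqb_id.
by apply: wire_ext He => x _; rewrite eqbF_neg.
Qed.

Lemma avail_grow (A : finType) k g (f : seq bool -> A) :
  (forall v e, grow k (g ++ e) (fun g' => wire a g' (fun x => f x == v))) ->
  grow (k * #|A|) g (fun g' => avail a g' f).
Proof.
move=> Hf; rewrite [#|A|]cardE.
have := @grow_all _ k (enum A) (fun w g' => wire a g' (fun x => f x == w)) g.
case=> [w|w e _|e le He]; [exact: wire_mono|exact: Hf|].
by exists e => // w; apply: He; rewrite mem_enum.
Qed.

Lemma avail_const (A : finType) g (v : A) :
  grow #|A| g (fun g' => avail a g' (fun _ => v)).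
Proof.
by rewrite -[#|A|]mul1n; apply: avail_grow => w e; apply: wire_const.
Qed.

Lemma avail_map (A B : finType) g (f : seq bool -> A) (h : A -> B) :
  avail a g f -> grow (#|A|.+1 * #|B|) g (fun g' => avail a g' (fun x => h (f x))).
Proof.
(* The test [h (f x) == w] is the disjunction of the tests [f x == v] over the preimages [v] of
   [w]. *)
move=> Hf; apply: avail_grow => w e; have := @wire_has _ [seq v <- enum A | h v == w] (fun v x => f x == v) (g ++ e).
case/(_ (fun v => wire_mono e (Hf v))) => e' le' He'; exists e'.
  by apply: leq_trans le' _; rewrite ltnS size_filter cardE count_size.
apply: wire_ext He' => x sx; apply/hasP/idP => [[v]|/eqP E].
  by rewrite mem_filter => /andP[/eqP<- _] /eqP->.
by exists (f x); rewrite // mem_filter E eqxx mem_enum.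
Qed.

Lemma avail_pair (A B : finType) g (f1 : seq bool -> A) (f2 : seq bool -> B) :
  avail a g f1 -> avail a g f2 ->
  grow #|{: A * B}| g (fun g' => avail a g' (fun x => (f1 x, f2 x))).
Proof.
move=> H1 H2; rewrite -[#|_|]mul1n; apply: avail_grow => -[v1 v2] e.
by have := wire_and (wire_mono e (H1 v1)) (wire_mono e (H2 v2)).
Qed.

Definition map2_cost (A B D : finType) := #|{: A * B}| + #|{: A * B}|.+1 * #|D|.

Lemma avail_map2 (A B D : finType) g (f1 : seq bool -> A) (f2 : seq bool -> B)
    (h : A -> B -> D) :
  avail a g f1 -> avail a g f2 ->
  grow (map2_cost A B D) g (fun g' => avail a g' (fun x => h (f1 x) (f2 x))).
Proof.
move=> H1 H2; apply: (grow_bind (avail_pair H1 H2)) => e He.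
exact: (avail_map (fun p => h p.1 p.2) He).
Qed.

(** A string whose bits depend on the input of the circuit under construction. *)
Definition vec := seq (seq bool -> bool).
Definition veval (v : vec) (x : seq bool) : seq bool := [seq f x | f <- v].
Definition vwire (g : seq gate) (v : vec) : Prop := List.Forall (wire a g) v.

Lemma vwire_mono v : mono (fun g => vwire g v).
Proof. by move=> g e; apply: List.Forall_impl => f; apply: wire_mono. Qed.

Lemma vwire_nth g v i :
  vwire g v -> i < size v -> wire a g (nth (fun=> false) v i).
Proof. by move=> H; elim: H i => [//|f w Hf _ IH] [|i] //=; apply: IH. Qed.

Lemma nth_veval v x i : nth false (veval v x) i = nth (fun=> false) v i x.
Proof. by elim: v i => [|f v IH] [|i] //=. Qed.

Lemma size_veval v x : size (veval v x) = size v.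
Proof. exact: size_map. Qed.

Lemma vwire_nthP g v :
  (forall i, i < size v -> wire a g (nth (fun=> false) v i)) -> vwire g v.
Proof.
elim: v => [|f v IH] H; constructor; first exact: (H 0).
by apply: IH => i; apply: (H i.+1).
Qed.

Lemma wire_circuit (C : circuit) (v : vec) g :
  vwire g v ->
  grow (size (gates C)).+1 g
    (fun g' => exists2 w : vec, vwire g' w & forall x, veval w x = ceval C (veval v x)).
Proof.
move=> Hv.
(* The one extra gate carries [false] and stands in for every reference of [C] to a nonexistent
   wire. *)
have [e0 le0 H0] := wire_const g false.
suff: grow (size (gates C)) (g ++ e0)
    (fun g' => exists2 w : vec, vwire g' w &
       forall x, veval w x = run (gates C) (veval v x)).
  case=> e le [w Hw Ew]; exists (e0 ++ e).
    by rewrite size_cat -addn1 addnC leq_add.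
  exists [seq nth (fun=> false) w o | o <- outs C]; last first.
    move=> x; rewrite /ceval -/(run _ _) -Ew /veval -map_comp; apply: eq_map => o.
    by rewrite /= nth_veval.
  rewrite catA; apply: vwire_nthP => i; rewrite size_map => lti.
  rewrite (nth_map 0) //; case: (ltnP (nth 0 (outs C) i) (size w)) => [/(vwire_nth Hw)//|].
  by move=> /(nth_default (fun=> false))->; apply: wire_mono.
have := vwire_mono e0 Hv; move: (g ++ e0) H0 => {}g H0 {}Hv.
elim: (gates C) v g H0 Hv => [|h hs IH] v g H0 Hv.
  by apply: grow_ret; exists v.
have Wn i : wire a g (nth (fun=> false) v i).
  by case: (ltnP i (size v)) => [/(vwire_nth Hv)//|/(nth_default (fun=> false))->].
have [f Hf Ef]: exists2 f, grow 1 g (fun g' => wire a g' f) &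
    forall x, f x = gval (veval v x) h.
  by case: h => [i j|i j|i] /=;
    [have := wire_and (Wn i) (Wn j) | have := wire_or (Wn i) (Wn j) | have := wire_not (Wn i)];
    (eexists; [eassumption|]) => x; rewrite !nth_veval.
rewrite /= -add1n.
apply: (grow_bind Hf) => e He.
have [||e' le' [w Hw Ew]] := IH (rcons v f) (g ++ e).
- exact: wire_mono.
- rewrite -cats1; apply/List.Forall_app; split; first exact: vwire_mono.
  by constructor.
by exists e' => //; exists w => // x; rewrite Ew /veval map_rcons Ef.
Qed.

End Avail.

(** The indices referring past the last gate read [false] and can be
    arbitrarily large, which would make the unary encoding long. *)
Definition clamp_gate (K : nat) (g : gate) : gate :=
  match g with
  | GAnd i j => GAnd (minn i K) (minn j K)
  | GOr i j => GOr (minn i K) (minn j K)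
  | GNot i => GNot (minn i K)
  end.

Definition clamp (K : nat) (C : circuit) : circuit :=
  Circuit (cin C) (map (clamp_gate K) (gates C)) (map (minn ^~ K) (outs C)).

Lemma nth_clamp (K i : nat) (ws : seq bool) :
  size ws <= K -> nth false ws (minn i K) = nth false ws i.
Proof.
move=> leK; rewrite /minn; case: ltnP => // leKi.
by rewrite !nth_default // (leq_trans leK).
Qed.

Lemma run_clamp K g x :
  size x + size g <= K -> run (map (clamp_gate K) g) x = run g x.
Proof.
elim: g x => [//|h g IH] x leK /=.
rewrite IH; last by rewrite size_rcons addSnnS.
congr (run g (rcons x _)).
have {}leK: size x <= K by rewrite (leq_trans _ leK) ?leq_addr.
by case: h => [i j|i j|i] /=; rewrite !nth_clamp.
Qed.

Lemma ceval_clamp K C x :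
  size x + size (gates C) <= K -> ceval (clamp K C) x = ceval C x.
Proof.
move=> leK; rewrite /ceval -!/(run _ _) /= run_clamp // -map_comp.
by apply: eq_map => o /=; rewrite nth_clamp // size_run.
Qed.

(** * Circuits simulating Turing machines *)

Section Simulation.
Variable M : ntm.
Implicit Types c : config M.

Definition action (q : state M) (h : option bool) (k : nat) : state M * option bool * move :=
  if halting q then (q, h, MStay) else nth (q, h, MStay) (delta q h) k.

(** Follows the [k]-th transition; a halted machine, or one without a
    [k]-th transition, stays where it is. *)
Definition simstep (k : nat) c : config M :=
  let: (q, l, h, r) := c in
  let: (q', a, mv) := action q h k in do_move q' l a r mv.

Fixpoint simn (ch : nat -> nat) (t : nat) c : config M :=
  if t is t'.+1 then simstep (ch t') (simn ch t' c) else c.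

Lemma reach_trans t1 t2 c1 c2 c3 :
  reach t1 c1 c2 -> reach t2 c2 c3 -> reach (t1 + t2) c1 c3.
Proof.
by elim=> [//|t c c' c'' s _ IH] /IH; rewrite addSn; apply: ReachS.
Qed.

Lemma simstep_reach k c : exists t, reach t c (simstep k c).
Proof.
case: c => [[[q l] h] r]; rewrite /simstep /action.
case: ifP => [_|/negbT nh]; first by exists 0; apply: Reach0.
case: (ltnP k (size (delta q h))) => [ltk|lek]; last first.
  by rewrite nth_default //; exists 0; apply: Reach0.
case E: nth => [[q' a] mv]; exists 1; apply: ReachS (Reach0 _).
apply: Step => //; rewrite -E.
elim: (delta q h) k ltk {E} => [//|x s IH] [|k] /= ltk; first by left.
by right; apply: IH.
Qed.

(** Soundness of guessed choices: an invalid choice leaves the configuration in place, so the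
    simulation never departs from a genuine run. *)
Lemma simn_reach ch t c : exists t', reach t' c (simn ch t c).
Proof.
elim: t => [|t [t1 H1]] /=; first by exists 0; apply: Reach0.
have [t2 H2] := simstep_reach (ch t) (simn ch t c).
by exists (t1 + t2); apply: reach_trans H2.
Qed.

Lemma simstep_halted k c : halting (cstate c) -> simstep k c = c.
Proof. by case: c => [[[q l] h] r] /= hq; rewrite /action hq. Qed.

Lemma step_simstep c c' : step c c' ->
  exists k, [/\ simstep k c = c' & exists q h, k < size (@delta M q h)].
Proof.
case=> q l h r q' a mv nh Hin.
have [k ltk Ek]: exists2 k, k < size (delta q h) &
    forall x0, nth x0 (delta q h) k = (q', a, mv).
  elim: (delta q h) Hin => [//|y s IH] /= [->|/IH[k ltk Ek]]; first by exists 0.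
  by exists k.+1.
exists k; split; last by exists q, h.
by rewrite /simstep /action (negbTE nh) Ek.
Qed.

Lemma simn_shift ch t c : simn ch t.+1 c = simn (fun i => ch i.+1) t (simstep (ch 0) c).
Proof. by elim: t => [//|t IH] /=; rewrite -IH. Qed.

Lemma eq_simn ch ch' t c : (forall i, i < t -> ch i = ch' i) -> simn ch t c = simn ch' t c.
Proof.
elim: t => [//|t IH] E /=; rewrite E // IH // => i lti.
by apply: E; apply: ltnW.
Qed.

Lemma simn_halted ch t c : halting (cstate c) -> simn ch t c = c.
Proof. by move=> hc; elim: t => [//|t IH] /=; rewrite IH simstep_halted. Qed.

(** A halted configuration is a fixed point of [simstep], so a shorter run can be padded to exactly
    [T] steps, the fixed length that a tableau needs. *)
Lemma reach_simn t c c' T (b : nat) : (forall q h, size (@delta M q h) <= b) ->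
  reach t c c' -> halting (cstate c') -> t <= T ->
  exists2 ch, (forall i, ch i <= b) & simn ch T c = c'.
Proof.
move=> Hb H; elim: H T => {t c c'} [c|t c c' c'' /step_simstep[k [Ek [q [h ltk]]]] _ IH] T hc leT.
  by exists (fun=> 0) => //; apply: simn_halted.
case: T leT => [//|T] leT; have [ch lech Ech] := IH T hc leT.
exists (fun i => if i is j.+1 then ch j else k).
  by case=> [|i] //; apply: leq_trans (Hb q h); apply: ltnW.
by rewrite simn_shift Ek -Ech; apply: eq_simn.
Qed.

Lemma reach_simn_det t c c' T : deterministic M ->
  reach t c c' -> halting (cstate c') -> t <= T -> simn (fun=> 0) T c = c'.
Proof.
move=> detM H; elim: H T => {t c c'} [c|t c c' c'' /step_simstep[k [Ek [q [h ltk]]]] _ IH] T hc leT.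
  exact: simn_halted.
case: T leT => [//|T] leT; have k0 : k = 0 by have := detM q h; lia.
by rewrite k0 in Ek; rewrite simn_shift Ek; apply: IH.
Qed.

(** * Tape cells and the locality of a step *)

Definition head_cell c : option bool := let: (_, _, h, _) := c in h.
Definition left_cell c (i : nat) : option bool := let: (_, l, _, _) := c in nth None l i.
Definition right_cell c (i : nat) : option bool := let: (_, _, _, r) := c in nth None r i.
Definition out_cell c (i : nat) : option bool :=
  if i is j.+1 then right_cell c j else head_cell c.

Definition tape_in (W : nat) c : Prop :=
  let: (_, l, _, r) := c in size l <= W /\ size r <= W.

Lemma tape_in_simn ch t x W : size x + t <= W -> tape_in W (simn ch t (init M x)).
Proof.
(* The left part starts empty, and a step lengthens either side by at most one cell. *)
suff: let: (_, l, _, r) := simn ch t (init M x) in size l <= t /\ size r <= size x + t.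
  by rewrite /tape_in; case: simn => [[[q l] h] r] [H1 H2]; lia.
elim: t => [|t] /=; first by case: x => [|b x] //=; rewrite size_map; split => //; lia.
case: simn => [[[q l] h] r] [H1 H2] /=; case: action => [[q' a] []] /=.
- by case: l H1 => [|b l] /= H1; split; lia.
- by case: r H2 => [|b r] /= H2; split; lia.
- by split; lia.
Qed.

Definition pick3 (T : Type) (mv : option bool) (x y z : T) : T :=
  match mv with Some false => x | Some true => y | None => z end.

(** One-hot wires need a [finType], so the three moves are coded in [option bool]. *)
Definition move_code (mv : move) : option bool :=
  match mv with MLeft => Some false | MRight => Some true | MStay => None end.

Definition action_code q h k : state M * option bool * option bool :=
  let: (q', a, mv) := action q h k in (q', a, move_code mv).

Definition code_of k c := action_code (cstate c) (head_cell c) k.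

Lemma cstate_simstep k c : cstate (simstep k c) = (code_of k c).1.1.
Proof.
case: c => [[[q l] h] r]; rewrite /code_of /action_code /=.
by case: action => [[q' a] []] //=; [case: l|case: r].
Qed.

(** Cells are indexed relative to the head, so a move shifts the whole tape. Still, each new cell
    depends only on the action and on boundedly many neighbouring cells; this locality is what gates
    can follow. *)
Lemma head_simstep k c : head_cell (simstep k c) =
  pick3 (code_of k c).2 (left_cell c 0) (right_cell c 0) (code_of k c).1.2.
Proof.
case: c => [[[q l] h] r]; rewrite /code_of /action_code /=.
by case: action => [[q' a] []] //=; [case: l|case: r].
Qed.

Lemma left_simstep k c i : left_cell (simstep k c) i =
  pick3 (code_of k c).2 (left_cell c i.+1)
    (if i is j.+1 then left_cell c j else (code_of k c).1.2) (left_cell c i).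
Proof.
case: c => [[[q l] h] r]; rewrite /code_of /action_code /=.
case: action => [[q' a] []] //=; first by case: l => [|? ?] //=; rewrite nth_nil.
by case: r; case: i.
Qed.

Lemma right_simstep k c i : right_cell (simstep k c) i =
  pick3 (code_of k c).2 (if i is j.+1 then right_cell c j else (code_of k c).1.2)
    (right_cell c i.+1) (right_cell c i).
Proof.
case: c => [[[q l] h] r]; rewrite /code_of /action_code /=.
case: action => [[q' a] []] //=; first by case: l; case: i.
by case: r => [|? ?] //=; rewrite nth_nil.
Qed.

(** The cell indices are unbounded; cells beyond the reach of the head are blank and can all share
    the wires of the constant [None]. *)
Definition avail_config (a : nat) (g : seq gate) (cf : seq bool -> config M) : Prop :=
  [/\ avail a g (fun x => cstate (cf x)), avail a g (fun x => head_cell (cf x)),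
      forall i, avail a g (fun x => left_cell (cf x) i) &
      forall i, avail a g (fun x => right_cell (cf x) i)].

Lemma avail_config_mono a cf : mono (fun g => avail_config a g cf).
Proof.
by move=> g e [H1 H2 H3 H4]; split=> *; apply: avail_mono => //; auto.
Qed.

Let cell : finType := option bool.
Definition pick_cost :=
  #|{: cell * cell}| + #|{: cell * cell}| + map2_cost (cell * cell)%type (cell * cell)%type cell.

Lemma avail_pick a g (mv x y z : seq bool -> cell) :
  avail a g mv -> avail a g x -> avail a g y -> avail a g z ->
  grow pick_cost g (fun g' => avail a g' (fun w => pick3 (mv w) (x w) (y w) (z w))).
Proof.
move=> Hm Hx Hy Hz; rewrite /pick_cost.
have H1 := avail_pair Hm Hx.
apply: grow_bind.
  apply: (@grow_bind _ _ _ _ (fun g' => avail a g' (fun w => (mv w, x w)) /\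
                                        avail a g' (fun w => (y w, z w))) H1) => e He.
  have [e' le' He'] := avail_pair (avail_mono e Hy) (avail_mono e Hz).
  by exists e' => //; split=> //; apply: avail_mono.
move=> e [He1 He2].
exact: (avail_map2 (fun p p' => pick3 p.1 p.2 p'.1 p'.2) He1 He2).
Qed.

(** The action is a function between finite sets fixed by [M] and [b], so its cost [K] can be chosen
    before the circuit; its value is left to be read off the construction. *)
Lemma avail_code b : exists K, forall a g cf (ch : seq bool -> 'I_b.+1),
  avail_config a g cf -> avail a g ch ->
  grow K g (fun g' => [/\ avail a g' (fun x => (code_of (ch x) (cf x)).1.1),
                          avail a g' (fun x => (code_of (ch x) (cf x)).1.2) &
                          avail a g' (fun x => (code_of (ch x) (cf x)).2)]).
Proof.
eexists => a g cf ch [Hq Hh _ _] Hch.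
apply: (grow_bind (avail_pair Hq Hh)) => e1 H1.
apply: (grow_bind (avail_map2 (fun p (k : 'I_b.+1) => action_code p.1 p.2 k) H1
                     (avail_mono e1 Hch))) => e2 H2.
apply: (grow_bind (avail_map (fun p => p.1.1) H2)) => e3 H3.
apply: (grow_bind (avail_map (fun p => p.1.2) (avail_mono e3 H2))) => e4 H4.
apply: (grow_bind (avail_map (fun p => p.2) (avail_mono e4 (avail_mono e3 H2)))) => e5 H5.
apply: (@grow_ret 0); split => //.
- exact: avail_mono (avail_mono _ H3).
- exact: avail_mono.
Qed.

(** One row of the tableau: one selection for the head and [W] on each side; the tape bound makes
    all farther cells blank. *)
Lemma avail_simstep b : exists K, forall a g W cf (ch : seq bool -> 'I_b.+1),
  avail_config a g cf -> avail a g ch -> avail a g (fun=> None : cell) ->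
  (forall x, size x = a -> tape_in W (simstep (ch x) (cf x))) ->
  grow (K * W.+1) g (fun g' => avail_config a g' (fun x => simstep (ch x) (cf x))).
Proof.
have [K HK] := avail_code b.
exists (K + (pick_cost + (pick_cost + pick_cost))) => a g W cf ch Hcf Hch HN HW.
apply: (@grow_leq (K + (pick_cost + (pick_cost * size (iota 0 W) + pick_cost * size (iota 0 W))))).
  by rewrite size_iota; nia.
apply: (grow_bind (HK _ _ _ _ Hcf Hch)) => e [Hq Ha Hm].
have {Hcf Hch HN} [[_ Hh Hl Hr] HN] := (avail_config_mono e Hcf, avail_mono e HN).
move: (g ++ e) Hq Ha Hm Hh Hl Hr HN => {g e} g Hq Ha Hm Hh Hl Hr HN.
have gh := avail_pick Hm (Hl 0) (Hr 0) Ha.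
have gl i e : grow pick_cost (g ++ e) (fun g' =>
    avail a g' (fun x => left_cell (simstep (ch x) (cf x)) i)).
  apply: grow_weaken (avail_pick (avail_mono e Hm) (avail_mono e (Hl i.+1))
    (_ : avail a (g ++ e) (fun x => if i is j.+1 then left_cell (cf x) j else
       (code_of (ch x) (cf x)).1.2)) (avail_mono e (Hl i))) => //.
    by move=> g'; apply: avail_ext => x _; rewrite left_simstep.
  by case: i => [|i]; apply: avail_mono.
have gr i e : grow pick_cost (g ++ e) (fun g' =>
    avail a g' (fun x => right_cell (simstep (ch x) (cf x)) i)).
  apply: grow_weaken (avail_pick (avail_mono e Hm)
    (_ : avail a (g ++ e) (fun x => if i is j.+1 then right_cell (cf x) j else
       (code_of (ch x) (cf x)).1.2)) (avail_mono e (Hr i.+1)) (avail_mono e (Hr i))) => //.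
    by move=> g'; apply: avail_ext => x _; rewrite right_simstep.
  by case: i => [|i]; apply: avail_mono.
apply: (grow_bind gh) => e1 H1.
have Gl := @grow_all _ pick_cost (iota 0 W) (fun i g' =>
    avail a g' (fun x => left_cell (simstep (ch x) (cf x)) i)) (g ++ e1).
have Gr e2 := @grow_all _ pick_cost (iota 0 W) (fun i g' =>
    avail a g' (fun x => right_cell (simstep (ch x) (cf x)) i)) ((g ++ e1) ++ e2).
apply: grow_bind.
  apply: Gl => [i|i e _]; first exact: avail_mono.
  by rewrite -catA; apply: gl.
move=> e2 H2; have [i|i e _|e3 le3 H3] := Gr e2.
- exact: avail_mono.
- by rewrite -!catA; apply: gr.
exists e3 => //; move: H1 H2 => /avail_mono-/(_ (e2 ++ e3)); rewrite catA => H1 H2.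
have {}H2 i ltiW := avail_mono e3 (H2 i ltiW).
have mono3 A f := @avail_mono a A f g (e1 ++ e2 ++ e3); rewrite !catA in mono3.
split.
- by apply: (avail_ext _ (mono3 _ _ Hq)) => x _; rewrite cstate_simstep.
- by apply: (avail_ext _ H1) => x _; rewrite head_simstep.
- move=> i; case: (ltnP i W) => [ltiW|leWi]; first by apply: H2; rewrite mem_iota.
  apply: (avail_ext _ (mono3 _ _ HN)) => x /HW.
  by case: simstep => [[[q l] h] r] [sl _] /=; rewrite nth_default ?(leq_trans sl).
- move=> i; case: (ltnP i W) => [ltiW|leWi]; first by apply: H3; rewrite mem_iota.
  apply: (avail_ext _ (mono3 _ _ HN)) => x /HW.
  by case: simstep => [[[q l] h] r] [_ sr] /=; rewrite nth_default ?(leq_trans sr).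
Qed.

Lemma avail_init : exists K, forall a g (v : vec), vwire a g v ->
  grow (K * (size v).+1) g (fun g' => avail_config a g' (fun x => init M (veval v x))).
Proof.
pose k1 := 1 + #|{: bool}|.+1 * #|cell|.
exists (k1 + #|cell| + #|state M|) => a g v Hv.
apply: (@grow_leq (#|state M| + (#|cell| + k1 * size (iota 0 (size v))))).
  by rewrite size_iota; nia.
apply: (grow_bind (avail_const a _ (q0 M))) => e Hq.
apply: (grow_bind (avail_const a _ (None : cell))) => e' HN.
have {}Hq := avail_mono e' Hq; have {Hv}Hv := vwire_mono e' (vwire_mono e Hv).
move: ((g ++ e) ++ e') Hq HN Hv => {}g Hq HN Hv.
have [i|i e2|e2 le2 H2] := @grow_all _ k1 (iota 0 (size v)) (fun i g' =>
    avail a g' (fun x => Some (nth false (veval v x) i) : cell)) g.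
- exact: avail_mono.
- rewrite mem_iota => ltiv.
  have Hw : wire a (g ++ e2) (fun x => nth false (veval v x) i).
    apply: (wire_ext _ (wire_mono e2 (vwire_nth Hv ltiv))) => x _.
    by rewrite nth_veval.
  apply: (grow_bind (avail_bool Hw)) => e3.
  exact: (avail_map (@Some bool)).
exists e2 => //; have {}Hq := avail_mono e2 Hq; have {}HN := avail_mono e2 HN.
have {}H2 i : i < size v -> avail a (g ++ e2) (fun x => Some (nth false (veval v x) i) : cell).
  by move=> lti; apply: H2; rewrite mem_iota.
case: v {Hv le2} H2 => [|f v] H2 /=; split=> //.
- by case.
- by case.
- exact: (H2 0).
- by case.
- move=> i; case: (ltnP i (size v)) => [lti|lei].
    by apply: (avail_ext _ (H2 i.+1 lti)) => x _; rewrite /right_cell (nth_map false) ?size_map.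
  by apply: avail_ext HN => x _; rewrite /right_cell nth_default // !size_map.
Qed.

(** The head moves at most one cell per step, so [T] rows with [size v + T] cells on each side of
    the head hold the whole run. *)
Lemma avail_simn b : exists K, forall a g (v : vec) (ch : nat -> seq bool -> 'I_b.+1) T,
  vwire a g v -> (forall t, t < T -> avail a g (ch t)) ->
  grow (K * (size v + T).+1 * T.+1) g
    (fun g' => avail_config a g' (fun x => simn (fun t => ch t x) T (init M (veval v x)))).
Proof.
have [K1 HK1] := avail_init; have [K2 HK2] := avail_simstep b.
exists (K1 + #|cell| + K2) => a g v ch T Hv Hch.
pose W := size v + T.
apply: (@grow_leq (K1 * (size v).+1 + (#|cell| + K2 * W.+1 * T))).
  rewrite /W; nia.
apply: (grow_bind (HK1 _ _ _ Hv)) => e H0.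
apply: (grow_bind (avail_const a _ (None : cell))) => e' HN.
have {}H0 := avail_config_mono e' H0.
have {Hv} Hch' t : t < T -> avail a ((g ++ e) ++ e') (ch t).
  by move=> /Hch /avail_mono/avail_mono.
move: ((g ++ e) ++ e') HN H0 Hch' => {}g HN H0 {}Hch.
suff: forall t, t <= T -> grow (K2 * W.+1 * t) g (fun g' =>
    avail_config a g' (fun x => simn (fun t => ch t x) t (init M (veval v x)))) by apply.
elim=> [|t IH] ltT; first by rewrite muln0; apply: grow_ret.
rewrite mulnSr; apply: (grow_bind (IH (ltnW ltT))) => e1 H1.
apply: HK2 => //; [exact/avail_mono/Hch|exact: avail_mono|] => x sx.
apply: (@tape_in_simn (fun t => ch t x) t.+1).
by rewrite size_veval /W leq_add2l.
Qed.

Lemma avail_out_cell a g cf i : avail_config a g cf ->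
  avail a g (fun x => out_cell (cf x) i).
Proof. by case: i => [|i] [_ Hh _ Hr]; [exact: Hh|exact: Hr]. Qed.

Lemma nth_read_bits s i : i < size (read_bits s) ->
  nth None s i = Some (nth false (read_bits s) i).
Proof. by elim: s i => [|[b|] s IH] [|i] //=; apply: IH. Qed.

(** The cell test alone would also accept an output that properly extends [w]; equality of the sizes
    excludes this. *)
Lemma output_cellP c (w : seq bool) : size (output c) = size w ->
  reflect (output c = w)
    (all (fun i => out_cell c i == Some (nth false w i)) (iota 0 (size w))).
Proof.
case: c => [[[q l] h] r] sw.
have E i : i < size w -> out_cell (q, l, h, r) i = Some (nth false (output (q, l, h, r)) i).
  by rewrite -sw => lti; apply: etrans (@nth_read_bits (h :: r) i lti); case: i {lti}.
apply: (iffP allP) => [H|Ew i]; last by rewrite mem_iota => /E->; rewrite Ew.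
apply: (@eq_from_nth _ false) => // i; rewrite sw => lti.
by have := H i; rewrite mem_iota E // => /(_ lti) /eqP[].
Qed.

End Simulation.

(** A choice in ['I_b.+1] is read off [b] bits as the position of the first [true]. *)
Definition pick_bit (b : nat) (bs : seq bool) : 'I_b.+1 := inord (find id bs).

Lemma avail_pick_bit b : exists K, forall a g (v : vec), size v <= b -> vwire a g v ->
  grow K g (fun g' => avail a g' (fun x => pick_bit b (veval v x))).
Proof.
pose k1 := map2_cost bool 'I_b.+1 'I_b.+1.
suff H: forall a g (v : vec), size v <= b -> vwire a g v ->
  grow (#|{: 'I_b.+1}| + (1 + k1) * size v) g
    (fun g' => avail a g' (fun x => pick_bit b (veval v x))).
  exists (#|{: 'I_b.+1}| + (1 + k1) * b) => a g v sv Hv.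
  by apply: grow_leq (H a g v sv Hv); rewrite leq_add2l leq_mul2l sv orbT.
move=> a g v; elim: v => [|f v IH] sv Hv.
  by rewrite muln0 addn0; exact: (@avail_const a _ g (pick_bit b [::])).
have [Hf Hv'] : wire a g f /\ vwire a g v by inversion Hv.
rewrite /= mulnSr addnA; apply: (grow_bind (IH (ltnW sv) Hv')) => e He.
apply: (grow_bind (avail_bool (wire_mono e Hf))) => e' Hf'.
(* The recursion of [find] on a cons; [inord] does not overflow because the whole string has at most
   [b] bits. *)
pose h (c : bool) (k : 'I_b.+1) : 'I_b.+1 := if c then ord0 else inord k.+1.
apply: grow_weaken (avail_map2 h Hf' (avail_mono e' He)) => // g'.
apply: avail_ext => x _; rewrite /h /pick_bit /=; case: (f x) => /=.
  by apply: val_inj; rewrite /= inordK.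
congr inord; rewrite inordK // ltnS.
by rewrite (leq_trans (find_size _ _)) // size_veval ltnW.
Qed.

(** * Extractors hit every selector *)

(** After [Rstruct] is loaded, [^] on [nat] denotes [Nat.pow], not [expn]. *)
Lemma powE a b : Nat.pow a b = expn a b.
Proof. by elim: b => //= b ->; rewrite expnS. Qed.

Section Hitting.
Import Order.TTheory GRing.Theory Num.Theory.
Local Open Scope ring_scope.

Lemma pow2_gt0 k : 0 < 2%:R ^+ k :> R. Proof. by rewrite exprn_gt0. Qed.

(** In [Defs] the numeral [2] cast to [R] is parsed as [IZR 2]. *)
Lemma IZR2E : IZR 2 = 2%:R.
Proof. by rewrite IZRposE INRE. Qed.

Lemma sum_tuple_const d (c : R) : \sum_(s : d.-tuple bool) c = 2%:R ^+ d * c.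
Proof. by rewrite sumr_const card_tuple card_bool -[LHS]mulr_natl natrX. Qed.

Lemma half_le (a b : R) : 2%:R * a <= b -> a <= 2%:R^-1 * b.
Proof. by lra. Qed.

(** Since the totals agree, the mass that [p] lacks at [z] reappears as an excess elsewhere, so the
    distance counts it twice. *)
Lemma l1_missed_point (I : finType) (p q : I -> R) (z : I) :
  \sum_i p i = \sum_i q i -> p z = 0 -> 2 * q z <= \sum_i `|p i - q i|.
Proof.
move=> E pz; rewrite (bigD1 z) //= pz sub0r normrN.
have le1: q z <= `|q z| := ler_norm _.
have le2: q z <= \sum_(i | i != z) `|p i - q i|.
  apply: le_trans (ler_norm_sum _ _ _).
  apply: le_trans (ler_norm _); rewrite sumrB.
  by move: E; rewrite (bigD1 z) //= [in RHS](bigD1 z) //= pz; lra.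
lra.
Qed.

(** The uniform distribution on [B] is a [k]-source. If [B] missed the selector, no pair [(s, z s)]
    would receive mass, and the error would be at least [2^-m], twice what is allowed. *)
Lemma extractor_hits (N d m k : nat) (E : N.-tuple bool -> d.-tuple bool -> m.-tuple bool)
    (B : {set N.-tuple bool}) (z : d.-tuple bool -> m.-tuple bool) :
  strong_extractor E k (pow2inv m.+1) -> (Nat.pow 2 k <= #|B|)%nat ->
  exists2 y, y \in B & exists s, E y s = z s.
Proof.
rewrite powE => HE leB.
have Bgt0: 0 < #|B|%:R :> R by rewrite ltr0n (leq_trans _ leB) // expn_gt0.
have [/existsP[y /andP[yB /existsP[s /eqP Es]]]|noy] :=
  boolP [exists y, (y \in B) && [exists s, E y s == z s]].
  by exists y => //; exists s.
exfalso; pose X := [ffun y : N.-tuple bool => if y \in B then GRing.inv #|B|%:R else 0%:R : R].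
have sumX: \sum_y X y = 1.
  under eq_bigr do rewrite ffunE.
  by rewrite -big_mkcond /= sumr_const -[LHS]mulr_natr mulVf // gt_eqF.
have kX: ksource X k.
  rewrite /ksource IZR2E; split; first by move=> y; rewrite ffunE; case: ifP => // _; rewrite invr_ge0 ltW.
  split=> // y; rewrite ffunE; case: ifP => _; last by rewrite invr_ge0 ltW ?pow2_gt0.
  by rewrite lef_pV2 ?posrE ?pow2_gt0 // -natrX ler_nat.
have /le_trans := HE X kX.
have dgt0 := pow2_gt0 d; have mgt0 := pow2_gt0 m.
(* Each of the [2^d] seeds contributes at least [2 * 2^-d * 2^-m] to the sum, and the factor one
   half cancels the 2. *)
suff lower: (2%:R ^+ m)^-1 <= sd_strong E X.
  have := le_trans lower (HE X kX); rewrite /pow2inv IZR2E exprS invfM.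
  have : 0 < (2%:R ^+ m)^-1 :> R by rewrite invr_gt0.
  by lra.
rewrite /sd_strong IZR2E RmultE.
apply: half_le.
have -> : 2%:R * (2%:R ^+ m)^-1 =
          \sum_(s : d.-tuple bool) 2%:R * ((2%:R ^+ d)^-1 * (2%:R ^+ m)^-1) :> R.
  by rewrite sum_tuple_const; field; rewrite !gt_eqF.
apply: ler_sum => s _.
apply: (@l1_missed_point _ (fun w => _ * (\sum_(x | E x s == w) X x)) (fun=> _) (z s)).
  have P : \sum_w \sum_(x | E x s == w) X x = 1.
    by rewrite -sumX [RHS](partition_big (E^~ s) predT).
  rewrite -mulr_sumr [X in _ * X]P mulr1.
  rewrite sum_tuple_const.
  by field; rewrite !gt_eqF.
rewrite big1 ?mulr0 // => y /eqP Ey; rewrite ffunE; case: ifP => // yB.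
by case/negP: noy; apply/existsP; exists y; rewrite yB /=; apply/existsP; exists s; rewrite Ey.
Qed.

(** If [N < m], every seed leaves some output string unattained, and selecting these strings
    contradicts [extractor_hits] for the full set. This later bounds [m n] polynomially in [n]. *)
Lemma extractor_output_le (N d m k : nat)
    (E : N.-tuple bool -> d.-tuple bool -> m.-tuple bool) :
  strong_extractor E k (pow2inv m.+1) -> (k <= N)%nat -> (m <= N)%nat.
Proof.
move=> HE lekN; rewrite leqNgt; apply/negP => ltNm.
have missed s : exists z, [forall y, E y s != z].
  apply/existsP; rewrite -[X in is_true X]negbK; apply/negP => /existsPn H.
  have : (#|[set: m.-tuple bool]| <= #|[set E y s | y in [set: N.-tuple bool]]|)%nat.
    apply/subset_leq_card/subsetP => z _.
    have /forallPn[y] := H z; rewrite negbK => /eqP <-.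
    exact: imset_f.
  move=> /leq_trans /(_ (leq_imset_card _ _)).
  by rewrite !cardsT !card_tuple card_bool leq_exp2l // leqNgt ltNm.
have Hz s := xchooseP (missed s).
have [|y _ [s Es]] := extractor_hits (B := setT) (fun s => xchoose (missed s)) HE.
  by rewrite powE cardsT card_tuple card_bool leq_exp2l.
by have /forallP/(_ y) := Hz s; rewrite Es eqxx.
Qed.

End Hitting.

(** * Polynomial bounds *)

Lemma expn_monol e i j : i <= j -> expn i e <= expn j e.
Proof. by case: e => // e; rewrite leq_exp2r. Qed.

(** The base [n.+2] is at least 2, so constants and sums are absorbed by the exponent, the only
    parameter. *)
Definition npoly (f : nat -> nat) : Prop := exists k, forall n, f n <= expn n.+2 k.

Lemma npoly_le f g : (forall n, f n <= g n) -> npoly g -> npoly f.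
Proof. by move=> le [k H]; exists k => n; apply: leq_trans (H n). Qed.

Lemma npoly_const c : npoly (fun=> c).
Proof.
exists c => n; apply: (@leq_trans (expn 2 c)); last exact: expn_monol.
exact/ltnW/ltn_expl.
Qed.

Lemma npoly_id : npoly id.
Proof. by exists 1 => n; rewrite expn1; lia. Qed.

Lemma npoly_mul f g : npoly f -> npoly g -> npoly (fun n => f n * g n).
Proof. by move=> [k H] [l H']; exists (k + l) => n; rewrite expnD leq_mul. Qed.

Lemma npoly_add f g : npoly f -> npoly g -> npoly (fun n => f n + g n).
Proof.
move=> [k H] [l H']; exists (k + l).+1 => n.
have := H n; have := H' n; rewrite expnS expnD.
have : 0 < expn n.+2 k by rewrite expn_gt0.
have : 0 < expn n.+2 l by rewrite expn_gt0.
nia.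
Qed.

Lemma npoly_succ f : npoly f -> npoly (fun n => (f n).+1).
Proof. by move=> Hf; apply: npoly_le (npoly_add (npoly_const 1) Hf). Qed.

Lemma npoly_exp f k : npoly f -> npoly (fun n => expn (f n) k).
Proof.
move=> Hf; elim: k => [|k IH]; first exact: npoly_const 1.
by apply: npoly_le (npoly_mul Hf IH) => n; rewrite expnS.
Qed.

Lemma poly_bounded_npoly f g : poly_bounded f g -> npoly g -> npoly f.
Proof.
move=> [c H] Hg; apply: npoly_le H _.
apply: npoly_add (npoly_const c); apply: npoly_mul (npoly_const c) _.
by apply: npoly_le (npoly_exp c Hg) => n; rewrite powE.
Qed.

(** Allowing every [k] above [n] makes the bound usable at [k = m n]. *)
Lemma npoly_bound f : npoly f -> exists c, forall n k, n <= k -> f n <= c * Nat.pow k c + c.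
Proof.
(* For positive [k], [k + 2 <= 3 * k] explains the factor [3 ^ e]; adding [e] makes the same
   constant serve as exponent, and the summand covers [k = 0]. *)
move=> [e H]; exists (expn 3 e + e) => n k lenk; apply: leq_trans (H n) _; rewrite powE.
apply: (@leq_trans (expn k.+2 e)); first by apply: expn_monol; lia.
case: k {lenk} => [|k].
  apply: (@leq_trans (expn 3 e)); last by lia.
  exact: expn_monol.
apply: (@leq_trans (expn 3 e * expn k.+1 e)).
  by rewrite -expnMn; apply: expn_monol; lia.
apply: leq_trans (leq_addr _ _); apply: leq_mul; first by lia.
by rewrite leq_pexp2l //; lia.
Qed.

Lemma npoly_poly_bounded f : npoly f -> poly_bounded f (fun n => n).
Proof. by move=> /npoly_bound[c H]; exists c => n; apply: H. Qed.

(** * The extractor as a circuit *)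

Definition cvec (bs : seq bool) : vec := [seq (fun=> b) | b <- bs].
Definition inputs (i k : nat) : vec := [seq (fun x => nth false x j) | j <- iota i k].

Lemma nth_inputs i k j x : j < k -> nth (fun=> false) (inputs i k) j x = nth false x (i + j).
Proof. by move=> ltj; rewrite (nth_map 0) ?size_iota // nth_iota. Qed.

Lemma size_inputs i k : size (inputs i k) = k.
Proof. by rewrite size_map size_iota. Qed.

Lemma veval_cvec bs x : veval (cvec bs) x = bs.
Proof. by rewrite /veval -map_comp map_id. Qed.

Lemma veval_cat v w x : veval (v ++ w) x = veval v x ++ veval w x.
Proof. exact: map_cat. Qed.

Lemma veval_inputs (x y z : seq bool) i k : size x = i -> size y = k ->
  veval (inputs i k) (x ++ y ++ z) = y.
Proof.
move=> sx sy; apply: (@eq_from_nth _ false); first by rewrite !size_map size_iota.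
move=> j; rewrite !size_map size_iota => ltj; rewrite nth_veval (nth_map 0) ?size_iota //.
rewrite nth_iota // nth_cat sx ltnNge leq_addr addKn.
by rewrite nth_cat sy ltj.
Qed.

Section Vectors.
Variables (a : nat) (g : seq gate).

Lemma vwire_cvec bs : (forall b : bool, wire a g (fun=> b)) -> vwire a g (cvec bs).
Proof. by move=> H; elim: bs => [|b bs IH]; constructor. Qed.

Lemma vwire_cat v w : vwire a g v -> vwire a g w -> vwire a g (v ++ w).
Proof. by move=> Hv Hw; apply/List.Forall_app. Qed.

Lemma vwire_inputs i k : i + k <= a -> vwire a g (inputs i k).
Proof.
elim: k i => [|k IH] i leik; constructor; first by apply: wire_input; lia.
by apply: IH; lia.
Qed.

Lemma vwire_outs v : vwire a g v -> exists2 o : seq nat, size o = size v &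
  forall x, size x = a -> map (nth false (run g x)) o = veval v x.
Proof.
elim=> [|f w [i _ Hi] _ [o so Ho]]; first by exists [::].
exists (i :: o) => /=; first by rewrite so.
by move=> x sx; rewrite Hi // Ho.
Qed.

End Vectors.

Lemma grow_consts a g : grow 2 g (fun g' => forall b : bool, wire a g' (fun=> b)).
Proof.
have [|b e _|e le H] := @grow_all _ 1 [:: true; false] (fun b g' => wire a g' (fun=> b)) g.
- by move=> b; apply: wire_mono.
- exact: wire_const.
by exists e => // -[]; apply: H.
Qed.

Lemma extractor_gadget (N d m : nat -> nat)
    (Ext : forall n, (N n).-tuple bool -> (d n).-tuple bool -> (m n).-tuple bool) :
  ptime_ext Ext -> npoly N -> npoly d ->
  exists2 S, npoly S & forall n a g (vy vs : vec),
    size vy = N n -> size vs = d n -> vwire a g vy -> vwire a g vs ->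
    grow (S n) g (fun g' => exists w : vec, [/\ vwire a g' w, size w = m n &
      forall x y s, size x = a -> veval vy x = val y -> veval vs x = val s ->
        veval w x = val (Ext n y s)]).
Proof.
move=> [M [detM [[c HT] HM]]] polyN polyd.
(* A deterministic machine has a single choice at each step, hence ['I_1]. *)
have [K HK] := avail_simn M 0.
(* The length of the machine's input: [n] in unary, the separator, the source string and the
   seed. *)
pose L n := n + (1 + (N n + d n)).
pose T n := c * Nat.pow (L n) c + c.
have polyL : npoly L.
  apply: npoly_add npoly_id _; apply: npoly_add (npoly_const 1) _.
  exact: npoly_add.
have polyT : npoly T.
  by apply: poly_bounded_npoly polyL; exists c.
exists (fun n => 2 + (#|'I_1| + K * (L n + T n).+1 * (T n).+1)).
  apply: npoly_add (npoly_const 2) _; apply: npoly_add (npoly_const _) _.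
  apply: npoly_mul; last exact: npoly_succ.
  by apply: npoly_mul (npoly_const K) _; apply/npoly_succ/npoly_add.
move=> n a g vy vs sy ss Hy Hs.
apply: (grow_bind (grow_consts a g)) => e Hc.
apply: (grow_bind (@avail_const a 'I_1 _ ord0)) => e' H0.
have {}Hc := vwire_cvec (nseq n true ++ [:: false]) Hc.
pose v := cvec (nseq n true ++ [:: false]) ++ (vy ++ vs).
have Hv : vwire a ((g ++ e) ++ e') v.
  by do 2?apply: vwire_cat; do ?apply: vwire_mono => //.
have sv : size v = L n.
  by rewrite /v !size_cat size_map size_cat size_nseq /= sy ss /L; lia.
have := HK a _ v (fun _ _ => ord0) (T n) Hv (fun _ _ => H0).
rewrite sv; apply: grow_weaken => // g'.
set cf := (fun x => simn _ _ _) => Hcf.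
exists [seq (fun x => out_cell (cf x) i == Some true) | i <- iota 0 (m n)].
split; last 1 first.
- move=> x y s sx Ey Es.
  have [t [cc [Hr [acc outE]]]] := HM n y s.
  have Ev : veval v x = nseq n true ++ false :: (val y ++ val s).
    by rewrite !veval_cat veval_cvec Ey Es -catA.
  have Ecf : cf x = cc.
    rewrite /cf Ev; apply: (reach_simn_det detM Hr); first by rewrite /halting acc eqxx.
    have := HT _ _ _ Hr; rewrite -Ev size_veval sv; exact.
  rewrite /veval -map_comp; apply: (@eq_from_nth _ false).
    by rewrite size_map size_iota size_tuple.
  move=> i; rewrite size_map size_iota => lti.
  rewrite (nth_map 0) ?size_iota //= nth_iota // add0n Ecf -outE.
  have /allP/(_ i) : all (fun i => out_cell cc i == Some (nth false (val (Ext n y s)) i))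
      (iota 0 (size (val (Ext n y s)))) by apply/output_cellP; rewrite outE.
  rewrite mem_iota size_tuple => /(_ lti) /eqP ->.
  by rewrite outE; case: nth.
- apply: vwire_nthP => i; rewrite size_map => lti; rewrite (nth_map 0) //.
  exact: avail_out_cell.
- by rewrite size_map size_iota.
Qed.

(** * Circuits with a hardwired seed *)

(** Wire [n] carries [true] and wire [K] does not exist, hence reads [false].
    The two gates have encodings of equal length that differ in one bit only,
    which is the seed bit itself. *)
Definition seed_gate (n K : nat) (b : bool) : gate := if b then GOr n K else GAnd n K.

(** The first gate [GNot n] reads its own, not yet defined, wire [n], which makes that wire [true].
    The seed gates then reproduce [s] on the wires that follow. *)
Definition seeded (n K : nat) (s : seq bool) (g : seq gate) (o : seq nat) : circuit :=
  clamp K (Circuit n (GNot n :: [seq seed_gate n K b | b <- s] ++ g) o).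

Lemma run_seeds n K x s0 s : size x = n -> n + (size s0 + size s) < K ->
  run [seq seed_gate n K b | b <- s] (x ++ true :: s0) = x ++ true :: s0 ++ s.
Proof.
move=> sx; elim: s s0 => [|b s IH] s0 /= ltK; first by rewrite cats0.
have -> : gval (x ++ true :: s0) (seed_gate n K b) = b.
  rewrite /seed_gate; case: b => /=; rewrite nth_cat sx ltnn subnn //=.
  by rewrite nth_default // size_cat /= sx; lia.
rewrite rcons_cat /= IH ?size_rcons; last by lia.
by rewrite -cats1 -catA.
Qed.

Lemma ceval_seeded n K s g o x : size x = n -> K = n + (1 + size s + size g) ->
  ceval (seeded n K s g o) x = map (nth false (run g (x ++ true :: s))) o.
Proof.
move=> sx EK; rewrite ceval_clamp; last first.
  by rewrite /= size_cat size_map sx EK; lia.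
rewrite /ceval -!/(run _ _) /= -/(run _ _) nth_default ?sx // -cats1 run_cat.
rewrite (@run_seeds n K x [::]) //= EK; lia.
Qed.

(** The list marker, the tag [false, b] of [GAnd] or [GOr], and the two clamped unary indices. *)
Definition seed_vec (n K : nat) (b : seq bool -> bool) : vec :=
  [:: fun=> true, fun=> false, b & cvec (enc_nat (minn n K) ++ enc_nat (minn K K))].

Definition enc_seeded (n K : nat) (vs : vec) (g : seq gate) (o : seq nat) : vec :=
  cvec (enc_nat n ++ true :: enc_gate (clamp_gate K (GNot n))) ++
  (flatten [seq seed_vec n K b | b <- vs] ++
   cvec (flatten [seq true :: enc_gate h | h <- map (clamp_gate K) g] ++ [:: false] ++
         flatten [seq true :: enc_nat i | i <- map (minn ^~ K) o] ++ [:: false])).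

(** Only the second tag bit of each seed gate varies with the seed, so the encoding is obtained from
    the seed wires and constants without further computation. *)
Lemma veval_enc_seeded n K vs g o x :
  veval (enc_seeded n K vs g o) x = enc_circuit (seeded n K (veval vs x) g o).
Proof.
rewrite /enc_seeded !veval_cat !veval_cvec /enc_circuit /= -!catA /=.

rewrite [enc_nat (minn n K)]/enc_nat -!catA /=.
congr (_ ++ [:: _, _, _ & _ ++ _ :: _]).
rewrite map_cat [in RHS]map_cat flatten_cat -!catA; congr (_ ++ _).
elim: vs => [//|b vs IH] /=; rewrite veval_cat IH !veval_cvec.
by rewrite /seed_gate; case: (b x).
Qed.

Lemma vwire_enc_seeded a gs n K vs g o : (forall b : bool, wire a gs (fun=> b)) ->
  vwire a gs vs -> vwire a gs (enc_seeded n K vs g o).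
Proof.
move=> Hc Hs; do 2?apply: vwire_cat; try exact: vwire_cvec.
elim: Hs => [|b w Hb _ IH]; first by constructor.
apply: (@vwire_cat _ _ (seed_vec n K b)) IH.
by do 3!(constructor; first by [|exact: Hc]); apply: vwire_cvec.
Qed.

Lemma size_flatten_le (T : Type) (P : nat) (ss : seq (seq T)) :
  all (fun s => size s <= P) ss -> size (flatten ss) <= P * size ss.
Proof.
by elim: ss => [//|s ss IH] /= /andP[les /IH]; rewrite size_cat mulnS; apply: leq_add.
Qed.

Lemma size_enc_nat k : size (enc_nat k) = k.+1.
Proof. by rewrite size_cat size_nseq addn1. Qed.

(** At most two tag bits and two unary indices of length at most [K + 1]. *)
Lemma size_enc_clamp K h : size (enc_gate (clamp_gate K h)) <= 2 * K + 4.
Proof.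
have sizeS b (s : seq bool) : size (b :: s) = (size s).+1 by [].
by case: h => [i j|i j|i]; rewrite /clamp_gate /enc_gate ?sizeS !size_cat !size_nseq /=; lia.
Qed.

Lemma size_enc_circuit_clamp K C :
  size (enc_circuit (clamp K C)) <=
    (cin C).+3 + (2 * K + 5) * size (gates C) + (K + 2) * size (outs C).
Proof.
rewrite /enc_circuit; set G := flatten _; set O := flatten _.
rewrite !size_cat size_nseq /=.
have HG : size G <= (2 * K + 5) * size (gates C).
  rewrite -(size_map (fun h => true :: enc_gate (clamp_gate K h))) /G -map_comp.
  apply: size_flatten_le; rewrite all_map; apply/allT => h /=.
  by have := size_enc_clamp K h; lia.
have HO : size O <= (K + 2) * size (outs C).
  rewrite -(size_map (fun i => true :: enc_nat (minn i K))) /O -map_comp.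
  apply: size_flatten_le; rewrite all_map; apply/allT => i /=.
  by rewrite size_enc_nat; lia.
lia.
Qed.

Lemma size_enc_seeded n K vs g o :
  size (enc_seeded n K vs g o) <=
    n.+3 + (2 * K + 5) * (1 + size vs + size g) + (K + 2) * size o.
Proof.
rewrite -(size_veval _ [::]) veval_enc_seeded; apply: leq_trans (size_enc_circuit_clamp _ _) _.
by rewrite /= size_cat size_map size_veval; lia.
Qed.

(** These are the gates shared by all [C_s]: the seed is still an input here, and [seeded] supplies
    it as wires. *)
Lemma extractor_after_generator (N d m : nat -> nat) (G : nat -> circuit)
    (Ext : forall n, (N n).-tuple bool -> (d n).-tuple bool -> (m n).-tuple bool) :
  ptime_ext Ext -> npoly N -> npoly d ->
  (forall n, has_shape (G n) n (N n)) -> npoly (fun n => csize (G n)) ->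
  exists2 S, npoly S & forall n, exists go : seq gate * seq nat,
    [/\ size go.1 <= S n, size go.2 = m n &
      forall x y s, size x = n -> ceval (G n) x = val y ->
        map (nth false (run go.1 (x ++ true :: val s))) go.2 = val (Ext n y s)].
Proof.
move=> ptExt polyN polyd shG polyG.
have [S polyS HS] := extractor_gadget ptExt polyN polyd.
exists (fun n => (csize (G n)).+1 + S n); first exact: npoly_add (npoly_succ polyG) polyS.
(* The wires are [x], then the constant [true] that [seeded] puts at position [n], then the seed
   from [n.+1] on. *)
move=> n; have [cinG outsG] := shG n; pose a := n + (1 + d n).
have Hx : vwire a [::] (inputs 0 n) by apply: vwire_inputs; rewrite /a; lia.
have Hs : vwire a [::] (inputs n.+1 (d n)) by apply: vwire_inputs; rewrite /a; lia.
have [e1 le1 [vy Hy Ey]] := @wire_circuit a (G n) (inputs 0 n) [::] Hx.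
have sy : size vy = N n by rewrite -(size_veval vy [::]) Ey size_map.
have [|e2 le2 [w [Hw sw Ew]]] := HS n a _ _ _ sy (size_inputs n.+1 (d n)) Hy.
  exact: vwire_mono.
have [o so Ho] := vwire_outs Hw.
exists (([::] ++ e1) ++ e2, o); split => /=.
- rewrite size_cat leq_add //; apply: leq_trans le1 _.
  by rewrite ltnS /csize; lia.
- by rewrite so.
- move=> x y s sx Eyx; have sxs : size (x ++ true :: val s) = a.
    by rewrite size_cat /= size_tuple sx /a; lia.
  rewrite Ho //; apply: Ew => //.
    rewrite Ey; apply: etrans Eyx; congr (ceval _ _).
    exact: (@veval_inputs [::] x (true :: val s)).
  have := @veval_inputs (x ++ [:: true]) (val s) [::] n.+1 (d n).
  rewrite cats0 -catA; apply; last by rewrite size_tuple.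
  by rewrite size_cat /= sx addn1.
Qed.

(** * Nondeterministic choices as blocks of witness bits *)

Definition choice_at (b base t : nat) (x : seq bool) : 'I_b.+1 :=
  pick_bit b (veval (inputs (base + t * b) b) x).

Lemma choice_realized b T (ch : nat -> nat) : (forall t, ch t <= b) ->
  exists w : (T * b).-tuple bool, forall y t, t < T ->
    nat_of_ord (choice_at b (size y) t (y ++ val w)) = ch t.
Proof.
(* Block [t] has a single [true], at position [ch t]; it is all [false] when [ch t = b], and then
   [find] returns [b]. *)
move=> lech; pose f k := (k %% b) == ch (k %/ b).
exists [tuple f (nat_of_ord k) | k < T * b] => y t ltT; rewrite /choice_at /pick_bit.
set bs := veval _ _.
have Ebs : bs = [seq j == ch t | j <- iota 0 b].
  apply: (@eq_from_nth _ false); first by rewrite size_veval size_inputs size_map size_iota.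
  move=> j; rewrite size_veval size_inputs => ltj.
  rewrite nth_veval nth_inputs // -addnA nth_cat ltnNge leq_addr addKn /=.
  have lt : t * b + j < T * b by nia.
  rewrite (nth_map 0) ?size_iota // nth_iota // add0n.
  have -> := (nth_mktuple (fun k : 'I_(T * b) => f k) false (Ordinal lt)).
  by rewrite /f /= modnMDl divnMDl ?modn_small ?divn_small ?addn0 //; lia.
rewrite inordK; last first.
  by rewrite ltnS (leq_trans (find_size _ _)) // size_veval size_inputs.
rewrite Ebs find_map.
have := lech t; rewrite leq_eqVlt => /orP[/eqP Eb|ltb].
  rewrite hasNfind ?size_iota ?Eb //; apply/hasPn => j; rewrite mem_iota /= -Eb add0n => lt.
  by rewrite neq_ltn lt.
apply/eqP; rewrite eqn_leq; apply/andP; split; rewrite leqNgt; apply/negP.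
  move=> /(before_find 0); rewrite nth_iota // add0n /= eqxx //.
move=> lt; have ltf : find (preim (fun j => j == ch t) id) (iota 0 b) < size (iota 0 b).
  by rewrite size_iota; apply: ltn_trans ltb.
have : has (preim (fun j => j == ch t) id) (iota 0 b) by rewrite has_find.
move=> /(nth_find 0); rewrite nth_iota ?add0n; last by rewrite size_iota in ltf.
by move=> /= /eqP E; move: lt; rewrite E ltnn.
Qed.

(** * The distinguisher *)

Lemma delta_bounded (M : ntm) : exists b, forall q h, size (@delta M q h) <= b.
Proof.
exists (\max_(p : state M * option bool) size (delta p.1 p.2)) => q h.
exact: (leq_bigmax (F := fun p : state M * option bool => size (delta p.1 p.2)) (q, h)).
Qed.

Lemma wire_cell_eq : exists k, forall a g (f : seq bool -> option bool) h,
  avail a g f -> wire a g h -> grow k g (fun g' => wire a g' (fun x => f x == Some (h x))).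
Proof.
eexists => a g f h Hf /avail_bool Hh; apply: (grow_bind Hh) => e {}Hh.
apply: grow_weaken (avail_map2 (fun u b => u == Some b) (avail_mono e Hf) Hh) => // g'.
by move=> /(_ true); apply: wire_ext => x _; rewrite eqb_id.
Qed.

Lemma expn_bound_mono c i j : i <= j -> c * Nat.pow i c + c <= c * Nat.pow j c + c.
Proof. by move=> leij; rewrite !powE leq_add2r leq_mul2l expn_monol ?orbT. Qed.

(** The witness is a seed followed by [T n] blocks of choice bits. The assumption on output lengths
    is what lets a comparison of [m n] cells decide equality of the outputs. *)
Lemma distinguisher (N d m : nat -> nat)
    (Ext : forall n, (N n).-tuple bool -> (d n).-tuple bool -> (m n).-tuple bool)
    (gs : nat -> seq gate) (os : nat -> seq nat) (M : ntm)
    (C := fun n s => seeded n (n + (1 + d n + size (gs n))) s (gs n) (os n)) :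
  ptime_ext Ext -> npoly N -> npoly d -> npoly m ->
  npoly (fun n => size (gs n)) -> (forall n, size (os n) = m n) -> poly_time M ->
  exists2 D, nd_family N D & forall n (y : (N n).-tuple bool),
    (forall (s : (d n).-tuple bool) z,
       accepts_with M (enc_circuit (C n s)) z -> size z = m n) ->
    ndeval (D n) (N n) y <->
      exists s : (d n).-tuple bool, accepts_with M (enc_circuit (C n s)) (val (Ext n y s)).
Proof.
move=> ptExt polyN polyd polym polygs sos [c HT].
have [SE polySE HE] := extractor_gadget ptExt polyN polyd.
have [b Hb] := delta_bounded M.
have [Ks HKs] := avail_simn M b.
have [Kp HKp] := avail_pick_bit b.
have [Kc HKc] := wire_cell_eq.
(* [K] counts the wires of [C_s], [L] bounds the length of its encoding, and [T] the running time of
   [M] on it. *)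
pose K n := n + (1 + d n + size (gs n)).
pose L n := n.+3 + (2 * K n + 5) * (1 + d n + size (gs n)) + (K n + 2) * m n.
pose T n := c * Nat.pow (L n) c + c.
have polyK1 : npoly (fun n => 1 + d n + size (gs n)).
  by apply: npoly_add polygs; apply: npoly_add (npoly_const 1) polyd.
have polyK : npoly K by apply: npoly_add npoly_id polyK1.
have polyL : npoly L.
  apply: npoly_add; last by apply: npoly_mul polym; apply: npoly_add polyK (npoly_const 2).
  apply: npoly_add; first by do 3!apply: npoly_succ; apply: npoly_id.
  apply: npoly_mul polyK1; apply: npoly_add (npoly_const 5).
  exact: npoly_mul (npoly_const 2) polyK.
have polyT : npoly T by apply: poly_bounded_npoly polyL; exists c.
(* In order: the constants, the extractor, the choices, the tableau of [M], the cell comparisons,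
   their conjunction, and the test for the accepting state. *)
pose SD n := 2 + (SE n + (Kp * T n + (Ks * (L n + T n).+1 * (T n).+1 +
                 (Kc * m n + ((m n).+1 + 1))))).
have polySD : npoly SD.
  apply: npoly_add (npoly_const 2) _; apply: npoly_add polySE _.
  apply: npoly_add; first exact: npoly_mul (npoly_const Kp) polyT.
  apply: npoly_add.
    apply: npoly_mul; last exact: npoly_succ.
    by apply: npoly_mul (npoly_const Ks) _; apply/npoly_succ/npoly_add.
  apply: npoly_add; first exact: npoly_mul (npoly_const Kc) polym.
  by apply: npoly_add (npoly_const 1); apply: npoly_succ.
pose cf n (s x : seq bool) :=
  simn (fun t => choice_at b (N n + d n) t x) (T n) (init M (enc_circuit (C n s))).
have /functional_choice[D HD] n : exists D : circuit,
    [/\ cin D = N n + d n + T n * b, size (outs D) = 1, size (gates D) <= SD n &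
     forall (y : (N n).-tuple bool) (s : (d n).-tuple bool) x,
       size x = cin D -> (exists w, x = y ++ s ++ w) ->
       ceval D x = [:: (cstate (cf n s x) == qacc M) &&
         all (fun i => out_cell (cf n s x) i == Some (nth false (val (Ext n y s)) i))
             (iota 0 (m n))]].
  (* The input is laid out as the tested string, the seed, and the choice bits. *)
  pose a := N n + d n + T n * b.
  pose vy := inputs 0 (N n); pose vs := inputs (N n) (d n).
  pose enc := enc_seeded n (K n) vs (gs n) (os n).
  pose cfx x := simn (fun t => choice_at b (N n + d n) t x) (T n) (init M (veval enc x)).
  pose acc (w : vec) x := (cstate (cfx x) == qacc M) &&
    all (fun i => out_cell (cfx x) i == Some (nth (fun=> false) w i x)) (iota 0 (m n)).
  have [g0 le0 [w [Ew [i _ Hi]]]] : grow (SD n) [::] (fun g => exists w : vec,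
      (forall x (y : (N n).-tuple bool) (s : (d n).-tuple bool), size x = a ->
        veval vy x = val y -> veval vs x = val s -> veval w x = val (Ext n y s)) /\
      wire a g (acc w)).
    apply: (grow_bind (grow_consts a [::])) => e1 Hc.
    move: ([::] ++ e1) Hc => g Hc.
    have Hy : vwire a g vy by apply: vwire_inputs; rewrite /a; lia.
    have Hs : vwire a g vs by apply: vwire_inputs; rewrite /a; lia.
    have He := vwire_enc_seeded n (K n) (gs n) (os n) Hc Hs.
    apply: (grow_bind (HE n a g vy vs (size_inputs _ _) (size_inputs _ _) Hy Hs)).
    move=> e2 [w [Hw sw Ew]].
    have {}He := vwire_mono e2 He; move: (g ++ e2) Hw He => {Hc Hy Hs} {}g Hw He.
    have Hch : grow (Kp * T n) g (fun g' => forall t, t < T n ->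
        avail a g' (choice_at b (N n + d n) t)).
      have [t|t e|e le H] := @grow_all _ Kp (iota 0 (T n))
          (fun t g' => avail a g' (choice_at b (N n + d n) t)) g.
      - exact: avail_mono.
      - rewrite mem_iota => ltT; apply: HKp; first by rewrite size_inputs.
        by apply: vwire_inputs; rewrite /a; nia.
      by exists e; [rewrite size_iota in le | move=> t ltT; apply: H; rewrite mem_iota].
    apply: (grow_bind Hch) => e3 {}Hch.
    have {}Hw := vwire_mono e3 Hw; have {}He := vwire_mono e3 He.
    move: (g ++ e3) Hw He Hch => {}g Hw He Hch.
    have Hsim : grow (Ks * (L n + T n).+1 * (T n).+1) g (fun g' => avail_config a g' cfx).
      apply: grow_leq (HKs a g enc _ (T n) He Hch).
      rewrite !leq_mul2r leq_mul2l ltnS leq_add2r; apply/orP; right; apply/orP; right.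
      by apply: leq_trans (size_enc_seeded _ _ _ _ _) _; rewrite size_inputs sos.
    apply: (grow_bind Hsim) => e4 Hcf.
    have {}Hw := vwire_mono e4 Hw; move: (g ++ e4) Hw Hcf => {He Hch Hsim} {}g Hw Hcf.
    pose eq_at i x := out_cell (cfx x) i == Some (nth (fun=> false) w i x).
    have Heq : grow (Kc * m n) g (fun g' => forall i, i \in iota 0 (m n) ->
        wire a g' (eq_at i)).
      rewrite -{1}(size_iota 0 (m n)); apply: grow_all => [i|i e]; first exact: wire_mono.
      rewrite mem_iota => lti; apply: HKc; last by apply/wire_mono/vwire_nth; rewrite ?sw.
      exact/avail_out_cell/avail_config_mono.
    apply: (grow_bind Heq) => e5 {}Heq.
    have Hq := wire_all Heq; rewrite size_iota in Hq.
    apply: (grow_bind Hq) => e6 {}Hq.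
    have [Hacc _ _ _] := avail_config_mono e6 (avail_config_mono e5 Hcf).
    have [e7 le7 H7] := wire_and (Hacc (qacc M)) Hq.
    by exists e7 => //; exists w.
  exists (Circuit a g0 [:: i]); split => //= y s x sx [u Ex].
  have Ey : veval vy x = val y.
    by rewrite Ex; apply: (@veval_inputs [::] y (s ++ u)); rewrite ?size_tuple.
  have Es : veval vs x = val s by rewrite Ex; apply: veval_inputs; rewrite size_tuple.
  rewrite /ceval /= -/(run _ _) Hi // /acc.
  have -> : cfx x = cf n s x by rewrite /cfx /cf veval_enc_seeded Es.
  congr [:: _ && _]; apply: eq_all => j.
  by rewrite -nth_veval (Ew x y s).
exists D.
  split; first by move=> n; have [-> ->] := HD n; rewrite -addnA leq_addr.
  apply: npoly_poly_bounded.
  apply: (npoly_le (g := fun n => (N n + d n + T n * b) + SD n + 1)).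
    by move=> n; have [sc so sg _] := HD n; rewrite /csize sc so leq_add2r leq_add2l.
  apply: npoly_add (npoly_const 1); apply: npoly_add polySD.
  apply: npoly_add (npoly_mul polyT (npoly_const b)).
  exact: npoly_add.
move=> n y szC; have [cinD _ _ evD] := HD n; split.
- case/existsP => z /eqP; set x := val y ++ val z => Hacc.
  have szx : size (val z) = d n + T n * b by rewrite size_tuple cinD; lia.
  have sds : size (take (d n) z) == d n by rewrite size_takel // szx leq_addr.
  pose s := Tuple sds; exists s.
  move: Hacc; rewrite (evD y s); last first.
  + by exists (drop (d n) z); rewrite /x /= cat_take_drop.
  + by rewrite /x size_cat szx size_tuple cinD addnA.
  case=> /andP[/eqP qacc_c Hout].
  (* Whatever the witness contains, the simulated run is genuine, so an accepting state means that
     [M] really produces this output. *)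
  have [t Ht] := simn_reach (fun t => choice_at b (N n + d n) t x) (T n)
    (init M (enc_circuit (C n s))).
  have Hac : accepts_with M (enc_circuit (C n s)) (output (cf n s x)) by exists t, (cf n s x).
  suff <- : output (cf n s x) = val (Ext n y s) by [].
  by apply/output_cellP; rewrite size_tuple ?(szC _ _ Hac).
- case=> s [t [c' [Hr [acc_c outE]]]].
  have leT : t <= T n.
    apply: leq_trans (HT _ _ _ Hr) _; apply: expn_bound_mono.
    have sv : size (inputs 0 (d n)) = size (val s) by rewrite size_inputs size_tuple.
    have := size_enc_circuit_clamp (K n)
      (Circuit n (GNot n :: [seq seed_gate n (K n) b | b <- s] ++ gs n) (os n)).
    by rewrite /= size_cat size_map size_tuple sos /L add1n addSn.
  have hc : halting (cstate c') by rewrite /halting acc_c eqxx.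
  (* Conversely, the choices of an accepting run, padded to [T n] steps, are written into the
     witness. *)
  have [ch lech Ech] := reach_simn Hb Hr hc leT.
  have [w Hw] := choice_realized (T n) lech.
  have sz : size (val s ++ val w) == cin (D n) - N n.
    by rewrite size_cat !size_tuple cinD; apply/eqP; lia.
  apply/existsP; exists (Tuple sz); apply/eqP.
  rewrite /= (evD y s); last first.
  + by exists w.
  + by rewrite !size_cat !size_tuple cinD addnA.
  congr [:: _]; have Ecf : cf n s (val y ++ val s ++ val w) = c'.
    rewrite /cf -Ech; apply: eq_simn => t' ltT.
    by have := Hw (val y ++ val s) t' ltT; rewrite -catA size_cat !size_tuple.
  rewrite Ecf acc_c eqxx /=.
  have sE : size (output c') = size (val (Ext n y s)) by rewrite outE.
  by have /output_cellP := outE => /(_ sE); rewrite size_tuple.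
Qed.

(** * Solving range avoidance breaks the demi-bits generator *)

Theorem theorem3p1
  (m N d : nat -> nat)
  (Hmn : forall n, n < m n)
  (HN : poly_bounded N m)
  (Hd : poly_bounded d m)
  (G : nat -> circuit)
  (HG : demibits_generator N G)
  (Ext : forall n, (N n).-tuple bool -> (d n).-tuple bool -> (m n).-tuple bool)
  (HExt_time : ptime_ext Ext)
  (HExt : forall n, strong_extractor (Ext n) (N n - 1)
                      (pow2inv (m n).+1)) :
  exists c : nat, ~ avoid_in_SearchNP m (fun k => c * k ^ c + c).
Proof.
have [ltnN [shG [polyG secG]]] := HG.
have {}polyG : npoly (fun n => csize (G n)) by apply: poly_bounded_npoly polyG npoly_id.
have polyN : npoly N.
  by apply: npoly_le polyG => n; have [_ <-] := shG n; apply: leq_addl.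
have lemN n : m n <= N n by apply: extractor_output_le (HExt n) (leq_subr _ _).
have polym : npoly m := npoly_le lemN polyN.
have polyd : npoly d := poly_bounded_npoly Hd polym.
have [S polyS HS] := extractor_after_generator HExt_time polyN polyd shG polyG.
have {HS}/functional_choice[go Hgo] := HS.
pose gs n := (go n).1; pose os n := (go n).2.
have polygs : npoly (fun n => size (gs n)).
  by apply: npoly_le polyS => n; have [] := Hgo n.
have sos n : size (os n) = m n by have [] := Hgo n.
pose C n (s : (d n).-tuple bool) := seeded n (n + (1 + d n + size (gs n))) s (gs n) (os n).
have csizeC n s : csize (@C n s) = n + (1 + d n + size (gs n)) + m n.
  by rewrite /csize /= !size_map size_cat size_map size_tuple sos.
have evC n x s y : size x = n -> ceval (G n) x = val y ->
    ceval (@C n s) x = val (Ext n y s).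
  move=> sx Ey; rewrite ceval_seeded ?size_tuple //.
  by have [_ _ /(_ x y s sx Ey)] := Hgo n.
have shC n s : has_shape (@C n s) n (m n) by split; rewrite //= size_map sos.
(* The size bound depends only on the generator and the extractor, so it is fixed before [M] is
   given. *)
have [p Hp] : exists p, forall n k, n <= k ->
    n + (1 + d n + size (gs n)) + m n <= p * Nat.pow k p + p.
  apply: npoly_bound; apply: npoly_add polym; apply: npoly_add npoly_id _.
  by apply: npoly_add polygs; apply: npoly_add (npoly_const 1) polyd.
exists p => -[M [ptM HM]].
have [D ndD HD] := distinguisher HExt_time polyN polyd polym polygs sos ptM.
(* Security forbids both conditions from holding at length [n0]; it remains to prove them there. *)
have [n0 /(_ n0 (leqnn n0))] := secG D ndD; set n := n0; apply.
have szC (s : (d n).-tuple bool) z :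
    accepts_with M (enc_circuit (C n s)) z -> size z = m n /\ ~ in_range (C n s) z.
  have [|_ H] := HM n (C n s) (shC n s); last exact: H.
  by rewrite csizeC; apply/Hp/ltnW.
have HDn y := HD n y (fun s z Hz => (szC s z Hz).1).
split; last first.
  (* If [G x] were accepted, [M] would output [Ext (G x, s)] on some [C_s], yet this is the value of
     [C_s] at [x]. *)
  move=> x; have sGx : size (ceval (G n) x) == N n.
    by have [_ <-] := shG n; rewrite size_map.
  apply/negP => /(HDn (Tuple sGx))[s /szC[_]]; apply.
  rewrite /in_range; exists x; exact: (evC n x s (Tuple sGx) (size_tuple x)).
set A := [set y | _]; rewrite leqNgt; apply/negP => smallA.
have /functional_choice[z Hz] (s : (d n).-tuple bool) : exists z : (m n).-tuple bool,
    accepts_with M (enc_circuit (C n s)) (val z).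
  have [|[z Hz] _] := HM n (C n s) (shC n s); first by rewrite csizeC; apply/Hp/ltnW.
  have /eqP sz := (szC s z Hz).1.
  by exists (Tuple sz).
have [|y] := extractor_hits (B := ~: A) z (HExt n).
  have := cardsC A; rewrite card_tuple card_bool => cA.
  (* Truncated subtraction is harmless as [N n > 0]. Fewer than a third of the strings being
     accepted, the rejected ones number at least [2 ^ (N n - 1)]. *)
  have E : expn 2 (N n) = 2 * expn 2 (N n - 1).
    by rewrite -expnS subn1 prednK // (leq_ltn_trans _ (ltnN n)).
  move: smallA cA; rewrite !powE E. move: #|A| #|~: A| => i j; lia.
(* A rejected [y] with [Ext (y, s) = z s] is a contradiction, since [z s] is an accepted output of
   [M] on [C_s]. *)
rewrite in_setC /A inE => nDy [s Es]; apply: (negP nDy); apply/HDn.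
by exists s; rewrite Es; apply: Hz.
Qed.
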